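(* Let $n\ge 1$, let $\alpha_1,\ldots,\alpha_n$ be real numbers with $\alpha_i>0$ for all $i$, and let $J_n$ be the $n\times n$ matrix built from $\alpha_1,\ldots,\alpha_n$ as described in the context. Then the $n$ eigenvalues of $J_n$ can be labelled $\lambda_1,\ldots,\lambda_n$ so that for each $k=1,\ldots,n$, $$\arctan\left(\frac{1}{\sqrt{4\lambda_k-1}}\right)+2\sum_{i=1}^{n}\arctan\left(\frac{\alpha_i}{\sqrt{4\lambda_k-1}}\right)=(2k-1)\frac{\pi}{2}.$$ Moreover, the $\lambda_k$ are real, positive, distinct, and monotonically decreasing in $k$.
   Context: $J_n=U_nV_n\in\mathbb{R}^{n\times n}$, where $U_n$ is the upper triangular matrix with entries $(U_n)_{ii}=\frac{\alpha_i+1}{2}$, $(U_n)_{ij}=\alpha_j$ for $i<j$, and $(U_n)_{ij}=0$ for $i>j$; and $V_n$ is the lower triangular matrix with entries $(V_n)_{ii}=\frac{\alpha_i+1}{2}$, $(V_n)_{ij}=\alpha_j$ for $i>j$, and $(V_n)_{ij}=0$ for $i<j$. The arctangent equation is understood over the reals: saying that $\lambda_k$ satisfies it means that $\lambda_k$ is real with $4\lambda_k-1>0$, the square root is the positive one, and $\arctan$ takes values in $(-\pi/2,\pi/2)$. *)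

(* Defs.v *)
From HB Require Import structures.
From mathcomp Require Import all_boot all_order all_algebra.
From mathcomp Require Import all_reals all_analysis.
From mathcomp Require Import complex.

Set Implicit Arguments.
Unset Strict Implicit.
Unset Printing Implicit Defensive.

Import Order.TTheory GRing.Theory Num.Theory.
Local Open Scope ring_scope.

Section Matrices.
Context {R : realType} {n : nat}.
Implicit Type alpha : 'I_n -> R.

Definition Umx alpha : 'M[R]_n :=
  \matrix_(i, j) (if i == j then (alpha i + 1) / 2
                  else if (i < j)%N then alpha j else 0).

Definition Vmx alpha : 'M[R]_n :=
  \matrix_(i, j) (if i == j then (alpha i + 1) / 2
                  else if (j < i)%N then alpha j else 0).

Definition Jmx alpha : 'M[R]_n := Umx alpha *m Vmx alpha.

(* The spectrum is taken over the complex numbers, so that the reality of the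
   eigenvalues is part of what is asserted. *)
Definition complexify (A : 'M[R]_n) : 'M[R[i]]_n := map_mx (real_complex R) A.

(* mu lists the complex eigenvalues of A, repeated with algebraic
   multiplicity. *)
Definition eigenvalue_labelling (A : 'M[R]_n) (mu : 'I_n -> R[i]) : Prop :=
  (forall z : R[i], eigenvalue (complexify A) z <-> exists k, z = mu k) /\
  char_poly (complexify A) = \prod_(k < n) ('X - (mu k)%:P).

End Matrices.

(* Main.v *)
Require Import Defs.
From HB Require Import structures.
From mathcomp Require Import all_boot all_order all_algebra.
From mathcomp Require Import all_reals all_analysis.
From mathcomp Require Import complex.
From mathcomp Require Import ring lra.

Set Implicit Arguments.
Unset Strict Implicit.
Unset Printing Implicit Defensive.

Import Order.TTheory GRing.Theory Num.Theory numFieldNormedType.Exports.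
Local Open Scope ring_scope.

(** The eigenvalue equation [J v = lam v] splits as [V v = w], [U w = lam v].
    Up to the diagonal terms, [V] takes the partial sums
    [b_i = \sum_(j < i) alpha_j v_j] and [U] the tail sums
    [c_i = \sum_(j >= i) alpha_j w_j]; with these,
    [w_i = v_i / 2 + (b_i + b_(i+1)) / 2] and
    [lam v_i = w_i / 2 + (c_i + c_(i+1)) / 2], under the boundary conditions
    [b_0 = 0] and [c_n = 0].  So the pair [(b, c)] follows the midpoint rule
    with steps [alpha_i] for a linear differential equation with constant
    coefficients in the plane.  For [lam = (s ^+ 2 + 1) / 4] with [s > 0] that
    equation is a rotation in suitable coordinates, and the step [alpha_i] turns
    it by the exact angle [2 * atan (alpha_i / s)].  The solution starting from
    [b_0 = 0] is thus given in closed form by sines and cosines of the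
    accumulated angle [phase s i], and the other condition [c_n = 0] becomes
    [s * cos (phase s n) = sin (phase s n)], that is
    [cos (atan (1 / s) + phase s n) = 0].  This is [Jmx_eigenvalue]: it suffices
    that [atan (1 / s) + phase s n] be an odd multiple of [pi / 2].

    As a function of [t = 1 / s] that sum, [atan_sum], is continuous and
    nondecreasing, vanishes at [0], and takes all positive values below
    [(2 * n + 1) * (pi / 2)] ([atan_sum_surj]).  Hence each of the [n] odd
    multiples [(2 * k - 1) * (pi / 2)], [1 <= k <= n], is attained, at points
    [s_k] that decrease with [k].  This gives [n] distinct real eigenvalues of
    an [n] by [n] matrix, so the characteristic polynomial is the product of the
    corresponding linear factors ([char_poly_distinct_eigenvalues]), and there
    are no others, even over the complex numbers. *)

(** * Sums and eigenvalues *)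

Lemma sum_ord_lt_telescope (V : zmodType) (n : nat) (f : nat -> V) (i : nat) :
  (i <= n)%N -> \sum_(j < n | (j < i)%N) (f j.+1 - f j) = f i - f 0%N.
Proof.
move=> le_in; rewrite -(big_ord_widen n (fun j => f j.+1 - f j) le_in).
by rewrite -(big_mkord xpredT (fun j => f j.+1 - f j)) telescope_sumr.
Qed.

Lemma sum_ord_gt_telescope (V : zmodType) (n : nat) (f : nat -> V) (i : nat) :
  (i < n)%N -> \sum_(j < n | (i < j)%N) (f j.+1 - f j) = f n - f i.+1.
Proof.
move=> lt_in; have := sum_ord_lt_telescope f (leqnn n).
rewrite (eq_bigl xpredT) => [|j]; last by rewrite ltn_ord.
rewrite (bigID (fun j : 'I_n => (j < i.+1)%N)) /= sum_ord_lt_telescope //.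
under eq_bigl => j do rewrite -leqNgt.
by move=> /(canRL (addKr _)) ->; rewrite opprB addrC addrA subrK.
Qed.

(** [eigenvalue] is about row vectors, whereas the eigenvectors built below are
    columns. *)
Lemma eigenvalue_tr (F : fieldType) (n : nat) (A : 'M[F]_n) (a : F) :
  eigenvalue A^T a = eigenvalue A a.
Proof.
rewrite /eigenvalue /eigenspace !kermx_eq0 !row_free_unit -unitmx_tr.
by rewrite linearB /= trmxK tr_scalar_mx.
Qed.

Lemma char_poly_distinct_eigenvalues (F : fieldType) (n : nat) (A : 'M[F]_n)
    (lam : 'I_n -> F) :
  injective lam -> (forall k, eigenvalue A (lam k)) ->
  char_poly A = \prod_(k < n) ('X - (lam k)%:P).
Proof.
move=> lam_inj eig; have := @all_roots_prod_XsubC _ (char_poly A) (codom lam).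
rewrite size_codom card_ord size_char_poly (monicP (char_poly_monic A)) scale1r.
rewrite /codom /image_mem big_map big_enum; apply=> //.
  by apply/allP => _ /mapP[k _ ->]; rewrite -eigenvalue_root_char.
by rewrite uniq_rootsE map_inj_uniq ?enum_uniq.
Qed.

(** * Trigonometric identities of one rotation step *)

Section Trigonometry.
Variable R : realType.
Implicit Types x m t : R.

Lemma sin_atan_mul x : sin (atan x) = x * cos (atan x).
Proof.
have c0 : cos (atan x) != 0.
  by apply/lt0r_neq0/cos_gt0_pihalf; rewrite atan_gtNpi2 atan_ltpi2.
by rewrite -{2}(atanK x) /tan divfK.
Qed.

(** The chord of an arc of angle [2 * atan x] is [x] times the sum of the radii
    at its ends, turned by a right angle: with [m] the middle angle, both sides
    below are a multiple of [cos m], and [sin_atan_mul] compares the factors.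
    It makes the midpoint rule an exact rotation. *)
Lemma sin_step_atan x t :
  sin (t + 2 * atan x) - sin t = x * (cos (t + 2 * atan x) + cos t).
Proof.
have [m ->] : exists m, t = m - atan x by exists (t + atan x); rewrite addrK.
have -> : m - atan x + 2 * atan x = m + atan x by ring.
rewrite sinB cosB sinD cosD sin_atan_mul; ring.
Qed.

Lemma cos_step_atan x t :
  cos t - cos (t + 2 * atan x) = x * (sin (t + 2 * atan x) + sin t).
Proof.
have [m ->] : exists m, t = m - atan x by exists (t + atan x); rewrite addrK.
have -> : m - atan x + 2 * atan x = m + atan x by ring.
rewrite sinB cosB sinD cosD sin_atan_mul; ring.
Qed.

Lemma cos_odd_pihalf (k : nat) : cos ((2 * k.+1%:R - 1) * (pi / 2)) = 0 :> R.
Proof.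
elim: k => [|k IHk].
  by rewrite (_ : _ * _ = pi / 2) ?cos_pihalf //; lra.
rewrite (_ : _ * _ = (2 * k.+1%:R - 1) * (pi / 2) + pi).
  by rewrite cosDpi IHk oppr0.
by rewrite -[k.+2%:R]natr1; field.
Qed.

End Trigonometry.

(** * The eigenvector attached to a solution of the phase condition *)

Section Eigenvector.
Context {R : realType} {n : nat}.
Variable alpha : 'I_n -> R.

Lemma Umx_mulE (w : 'cV[R]_n) (i : 'I_n) :
  (Umx alpha *m w) i 0
  = (alpha i + 1) / 2 * w i 0 + \sum_(j < n | (i < j)%N) alpha j * w j 0.
Proof.
rewrite mxE (bigD1 i) //= mxE eqxx; congr (_ + _).
rewrite big_mkcond [RHS]big_mkcond; apply: eq_bigr => j _; rewrite mxE eq_sym.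
by have [->|] := eqVneq; rewrite ?ltnn //=; case: ifP; rewrite ?mul0r.
Qed.

Lemma Vmx_mulE (v : 'cV[R]_n) (i : 'I_n) :
  (Vmx alpha *m v) i 0
  = (alpha i + 1) / 2 * v i 0 + \sum_(j < n | (j < i)%N) alpha j * v j 0.
Proof.
rewrite mxE (bigD1 i) //= mxE eqxx; congr (_ + _).
rewrite big_mkcond [RHS]big_mkcond; apply: eq_bigr => j _; rewrite mxE eq_sym.
by have [->|] := eqVneq; rewrite ?ltnn //=; case: ifP; rewrite ?mul0r.
Qed.

Definition phase (s : R) (i : nat) : R :=
  \sum_(j < n | (j < i)%N) 2 * atan (alpha j / s).

Lemma phase0 s : phase s 0 = 0.
Proof. by rewrite /phase big_pred0. Qed.

Lemma phase_full s : phase s n = 2 * \sum_(j < n) atan (alpha j / s).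
Proof. by rewrite mulr_sumr; apply: eq_bigl => j; rewrite ltn_ord. Qed.

Lemma phaseS s (i : 'I_n) : phase s i.+1 = phase s i + 2 * atan (alpha i / s).
Proof.
rewrite /phase (bigD1 i) //= addrC; congr (_ + _).
by apply: eq_bigl => j; rewrite ltnS [in RHS]ltn_neqAle andbC.
Qed.

(** The sequences [b], [c], [v], [w] of the midpoint recursion, normalised by
    [c_0 = s / 2].  They solve it, together with [b_0 = 0], for every [s > 0];
    the end condition [c_n = 0] is what selects [s]. *)
Section ShootingSolution.
Variable s : R.
Hypothesis s_gt0 : 0 < s.

Let th := phase s.
Definition shoot_b (i : nat) : R := sin (th i).
Definition shoot_c (i : nat) : R := (s * cos (th i) - sin (th i)) / 2.
Definition shoot_v (i : nat) : R := (cos (th i) + cos (th i.+1)) / s.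
Definition shoot_w (i : nat) : R := (shoot_v i + shoot_b i + shoot_b i.+1) / 2.

Lemma shoot_bS (i : 'I_n) : alpha i * shoot_v i = shoot_b i.+1 - shoot_b i.
Proof.
rewrite /shoot_b /shoot_v /th phaseS sin_step_atan; ring.
Qed.

Lemma shoot_cS (i : 'I_n) : alpha i * shoot_w i = - (shoot_c i.+1 - shoot_c i).
Proof.
have bE := shoot_bS i; have := cos_step_atan (alpha i / s) (th i).
rewrite -phaseS -/th => /(congr1 ( *%R s)).
rewrite mulrA [s * (_ / _)]mulrC divfK ?gt_eqF // => cE.
rewrite /shoot_w !mulrA 2!mulrDr bE.
move: bE cE; rewrite /shoot_c /shoot_b; lra.
Qed.

Lemma Vmx_shoot :
  Vmx alpha *m (\col_i shoot_v i) = \col_i shoot_w i.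
Proof.
apply/colP => i; rewrite Vmx_mulE !mxE.
under eq_bigr do rewrite mxE shoot_bS.
rewrite sum_ord_lt_telescope 1?ltnW // {2}/shoot_b /th phase0 sin0 subr0.
rewrite /shoot_w; have := shoot_bS i; lra.
Qed.

(** The eigenvalue comes from [lam v_i = w_i / 2 + (c_i + c_(i+1)) / 2]: the sine
    terms of [w] and [c] cancel and [s * (cos + cos) = s ^+ 2 * v_i] remains,
    next to [v_i]. *)
Lemma Umx_shoot :
  shoot_c n = 0 ->
  Umx alpha *m (\col_i shoot_w i) = \col_i ((s ^+ 2 + 1) / 4 * shoot_v i).
Proof.
move=> cn0; apply/colP => i; rewrite Umx_mulE !mxE.
under eq_bigr do rewrite mxE shoot_cS.
rewrite sumrN sum_ord_gt_telescope // cn0.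
have sv : s * shoot_v i = cos (th i) + cos (th i.+1).
  by rewrite mulrC divfK ?gt_eqF.
have -> : (s ^+ 2 + 1) / 4 * shoot_v i
  = (s * (cos (th i) + cos (th i.+1)) + shoot_v i) / 4 by rewrite -sv; field.
have -> : (alpha i + 1) / 2 * shoot_w i
  = alpha i * shoot_w i / 2 + shoot_w i / 2 by field.
rewrite shoot_cS /shoot_c /shoot_w /shoot_b; lra.
Qed.

End ShootingSolution.

(** Expanding the cosine turns the hypothesis into
    [s * cos (phase s n) = sin (phase s n)], which is [c_n = 0]. *)
Lemma Jmx_eigenvalue (s : R) :
  (0 < n)%N -> 0 < s ->
  cos (atan (1 / s) + 2 * \sum_(i < n) atan (alpha i / s)) = 0 ->
  eigenvalue (Jmx alpha) ((s ^+ 2 + 1) / 4).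
Proof.
move=> n_gt0 s_gt0 cosF; rewrite -eigenvalue_tr; apply/eigenvalueP.
have s0 : s != 0 by rewrite gt_eqF.
have cn0 : shoot_c s n = 0.
  have c_gt0 : 0 < cos (atan (1 / s)).
    by apply: cos_gt0_pihalf; rewrite atan_gtNpi2 atan_ltpi2.
  move: cosF; rewrite -phase_full cosD sin_atan_mul => cosF.
  apply: (mulfI (lt0r_neq0 c_gt0)); rewrite mulr0 -[RHS](mulr0 (s / 2)) -cosF.
  by rewrite /shoot_c; field.
exists (\col_i shoot_v s i)^T.
  rewrite -trmx_mul -mulmxA Vmx_shoot Umx_shoot //.
  by apply/rowP => i; rewrite !mxE.
(* The first entry of [v] is [(1 + cos (2 * h)) / s = 2 * cos h ^+ 2 / s] with
   [h = atan (alpha_0 / s)], hence nonzero. *)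
apply/eqP => /rowP /(_ (Ordinal n_gt0)); rewrite !mxE /shoot_v.
rewrite (phaseS s (Ordinal n_gt0)) phase0 add0r cos0 mulr_natl cos_mulr2n.
move/eqP; rewrite mulf_eq0 invr_eq0 (negPf s0) orbF addrC subrK.
rewrite mulrn_eq0 /= expf_eq0 /= gt_eqF //.
by apply: cos_gt0_pihalf; rewrite atan_gtNpi2 atan_ltpi2.
Qed.

End Eigenvector.

(** * Solving the arctangent equation *)

Section ArctangentEquation.
Context {R : realType} {n : nat}.
Variable alpha : 'I_n -> R.
Hypothesis alpha_gt0 : forall i, 0 < alpha i.

(** The left-hand side of the arctangent equation, in the variable
    [t = 1 / s], in which it extends continuously to [t = 0]. *)
Definition atan_sum (t : R) : R :=
  atan t + 2 * \sum_(i < n) atan (alpha i * t).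

Lemma atan_sum_le : {homo atan_sum : x y / x <= y}.
Proof.
move=> x y xy; rewrite /atan_sum; apply: lerD; first exact: le_atan.
rewrite ler_pM2l ?ltr0n //; apply: ler_sum => i _; apply: le_atan.
by rewrite ler_pM2l.
Qed.

Lemma atan_sum_continuous : continuous atan_sum.
Proof.
move=> x; apply: cvgD; first exact: continuous_atan.
apply: cvgM; first exact: cvg_cst.
apply: cvg_big => [|i _]; first exact: add_continuous.
apply: (@continuous_comp _ _ _ (fun t => alpha i * t) atan).
  exact: mulrl_continuous.
exact: continuous_atan.
Qed.

(** By the intermediate value theorem on [[0, t0]], it is enough to find [t0] with
    [x <= atan_sum t0].  Spreading [x] evenly over the [2 * n + 1] arctangents
    gives the angle [y < pi / 2], and [t0] is chosen such that each arctangent is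
    at least [y]. *)
Lemma atan_sum_surj (x : R) :
  0 < x -> x < (2 * n%:R + 1) * (pi / 2) -> exists2 t, 0 < t & atan_sum t = x.
Proof.
move=> x_gt0 x_lt.
have N_gt0 : 0 < 2 * n%:R + 1 :> R by rewrite ltr_wpDl ?mulr_ge0.
set y := x / (2 * n%:R + 1).
have y_gt0 : 0 < y by rewrite divr_gt0.
have y_lt : y < pi / 2 by rewrite ltr_pdivrMr // mulrC.
have tany : atan (tan y) = y.
  rewrite tanK // in_itv /= y_lt andbT (lt_trans _ y_gt0) // oppr_lt0.
  by rewrite divr_gt0 ?pi_gt0.
have tany_gt0 : 0 < tan y.
  by rewrite ltNge; apply/negP => /le_atan; rewrite tany atan0 leNgt y_gt0.
(* Both [t0] and every [alpha i * t0] are at least [tan y]. *)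
pose t0 := tan y * (1 + \sum_i (alpha i)^-1).
have inv_ge0 i : 0 <= (alpha i)^-1 by rewrite invr_ge0 ltW.
have t0_ge0 : 0 <= t0 by rewrite mulr_ge0 ?ltW // ltr_wpDr // sumr_ge0.
have G0 : atan_sum 0 = 0.
  by rewrite /atan_sum atan0 big1 ?mulr0 ?addr0 // => i _; rewrite mulr0 atan0.
have Gt0 : x <= atan_sum t0.
  have -> : x = y + 2 * \sum_(i < n) y.
    rewrite sumr_const card_ord -mulr_natl /y; field.
    by rewrite gt_eqF.
  rewrite -{1 2}tany; apply: lerD.
    apply: le_atan; rewrite ler_peMr ?(ltW tany_gt0) // lerDl; exact: sumr_ge0.
  rewrite ler_pM2l ?ltr0n //; apply: ler_sum => i _; apply: le_atan.
  rewrite /t0 mulrCA ler_peMr ?(ltW tany_gt0) // mulrDr mulr1 (bigD1 i) //= mulrDr.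
  rewrite divff ?gt_eqF // addrCA lerDl; apply: addr_ge0; first exact: ltW.
  by apply: mulr_ge0; [exact: ltW | exact: sumr_ge0].
have [|t] := @IVT R atan_sum 0 t0 x t0_ge0 (continuous_subspaceT atan_sum_continuous).
  by rewrite G0 ge_min ltW //= le_max Gt0 orbT.
rewrite in_itv /= => /andP[t_ge0 _] Gt; exists t => //.
rewrite lt_neqAle t_ge0 andbT; apply/eqP => t0E.
by move: x_gt0; rewrite -Gt -t0E G0 ltxx.
Qed.

End ArctangentEquation.

Theorem corollary4p1 (R : realType) (n : nat) (hn : (1 <= n)%N)
    (alpha : 'I_n -> R) (halpha : forall i, 0 < alpha i) :
  exists lam : 'I_n -> R,
    [/\ eigenvalue_labelling (Jmx alpha) (fun k => real_complex R (lam k)),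
        forall k : 'I_n,
          0 < 4 * lam k - 1 /\
          atan (1 / Num.sqrt (4 * lam k - 1))
            + 2 * \sum_(i < n) atan (alpha i / Num.sqrt (4 * lam k - 1))
          = (2 * (k.+1)%:R - 1) * (pi / 2),
        forall k, 0 < lam k,
        injective lam &
        forall k l : 'I_n, (k < l)%N -> lam l < lam k].
Proof.
pose target (k : 'I_n) : R := (2 * (k.+1)%:R - 1) * (pi / 2).
have pi2_gt0 : 0 < pi / 2 :> R by rewrite divr_gt0 ?pi_gt0.
have sol (k : 'I_n) : exists s : R, 0 < s /\
    atan (1 / s) + 2 * \sum_(i < n) atan (alpha i / s) = target k.
  have kn : k.+1%:R <= n%:R :> R by rewrite ler_nat.
  have k1 : 1 <= k.+1%:R :> R by rewrite ler1n.
  have [||t t_gt0 Gt] := @atan_sum_surj R n alpha halpha (target k).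
  - by rewrite mulr_gt0 //; lra.
  - by rewrite ltr_pM2r //; lra.
  by exists t^-1; rewrite invr_gt0 t_gt0 invrK mul1r; split.
have [s sP] := boolp.choice sol.
have s_gt0 k : 0 < s k by case: (sP k).
(* Monotonicity in the wide sense suffices, because the targets are distinct. *)
have s_decr (k l : 'I_n) : (k < l)%N -> s l < s k.
  move=> kl; rewrite ltNge; apply/negP => sle.
  have : (s l)^-1 <= (s k)^-1 by rewrite lef_pV2 ?posrE.
  move/(atan_sum_le halpha); rewrite -[X in atan X + _ <= _]mul1r.
  rewrite -[X in _ <= atan X + _]mul1r (sP l).2 (sP k).2 /target.
  have : k.+1%:R < l.+1%:R :> R by rewrite ltr_nat.
  by rewrite ler_pM2r //; lra.
pose lam k := (s k ^+ 2 + 1) / 4.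
have lamE k : 4 * lam k - 1 = s k ^+ 2 by rewrite /lam; field.
have lam_decr (k l : 'I_n) : (k < l)%N -> lam l < lam k.
  move=> /s_decr sl; rewrite /lam ltr_pM2r ?invr_gt0 ?ltr0n // ltrD2r.
  by rewrite ltr_pXn2r // nnegrE ltW.
have lam_inj : injective lam.
  move=> k l e; apply: val_inj; case: (ltngtP k l) => // /lam_decr.
    by rewrite e ltxx.
  by rewrite e ltxx.
have eig k : eigenvalue (Jmx alpha) (lam k).
  by apply: Jmx_eigenvalue => //; rewrite (sP k).2 cos_odd_pihalf.
have charE : char_poly (complexify (Jmx alpha))
    = \prod_(k < n) ('X - (real_complex R (lam k))%:P).
  rewrite /complexify -map_char_poly (char_poly_distinct_eigenvalues lam_inj) //.
  rewrite rmorph_prod; apply: eq_bigr => k _.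
  by rewrite rmorphB /= map_polyX map_polyC.
exists lam; split=> //.
- split=> // z; rewrite eigenvalue_root_char charE.
  rewrite -(big_map (fun k => real_complex R (lam k)) xpredT
              (fun c => 'X - c%:P)) root_prod_XsubC.
  split=> [/mapP[k _ ->]|[k ->]]; first by exists k.
  by apply: map_f; rewrite mem_index_enum.
- move=> k; rewrite lamE sqrtr_sqr gtr0_norm //.
  by split; [exact: exprn_gt0 | exact: (sP k).2].
- move=> k; apply: divr_gt0; last exact: ltr0n.
  by apply: ltr_wpDl; first exact: sqr_ge0.
Qed.
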